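(* Let $0\le\gamma\le D^*$ and $k\in\mathbb Z^+$. Let $(E_1,E_2)\in(\mathcal R_{FD}\cup\mathcal B(\gamma))\cap(\gamma+k\mathcal R_{FD})$, where $\gamma+k\mathcal R_{FD}=\{(\gamma+ka,\gamma+kb):(a,b)\in\mathcal R_{FD}\}$. Then for every $\delta>0$ there exist real thresholds $\beta_1\le\alpha_1$ and $\alpha$, not depending on $n$, such that for all sufficiently large $n$ the two-phase test with parameters $(n,k,\alpha_1,\beta_1,\alpha)$ satisfies: - $\tau\le(k+1)n$; - $\mathsf P_i(\tau>n)\le e^{-\gamma n}$ for $i=1,2$; - $\mathsf P_1(d=2)\le e^{-(E_1-\delta)n}$; - $\mathsf P_2(d=1)\le e^{-(E_2-\delta)n}$. In particular, two-phase tests achieve every pair in $\mathcal R_\gamma\cap(\gamma+k\mathcal R_{FD})$.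
   Context: Standing assumptions: $\mathcal X$ is a finite set and $\mathsf P_1,\mathsf P_2$ are two distinct probability mass functions on $\mathcal X$, both with full support. Under hypothesis $H_i$ the observations $X_1,X_2,\dots$ are i.i.d. with law $\mathsf P_i$, and $\mathsf P_i(\cdot)$ denotes probability under $H_i$. $D(P\|Q)=\sum_{x}P(x)\log\frac{P(x)}{Q(x)}$. Tilted distributions: $\mathsf P^{(\lambda)}(x)=\frac{\mathsf P_1^{1-\lambda}(x)\mathsf P_2^{\lambda}(x)}{\sum_{a}\mathsf P_1^{1-\lambda}(a)\mathsf P_2^{\lambda}(a)}$ for $\lambda\in[0,1]$. Chernoff exponent: $\lambda^*\in[0,1]$ satisfies $D(\mathsf P^{(\lambda^* )}\|\mathsf P_1)=D(\mathsf P^{(\lambda^* )}\|\mathsf P_2)$, and $D^*=D(\mathsf P^{(\lambda^* )}\|\mathsf P_1)$. Regions: - $\mathcal R_{FD}=\{(E_1,E_2)\in\mathbb R^2:\exists\lambda\in[0,1],\ E_i\le D(\mathsf P^{(\lambda)}\|\mathsf P_i),\ i=1,2\}$. - $E_1(\gamma)=\max\{D(\mathsf P^{(\lambda)}\|\mathsf P_1):\lambda\in[0,1],\ D(\mathsf P^{(\lambda)}\|\mathsf P_2)\ge\gamma\}$. - $E_2(\gamma)=\max\{D(\mathsf P^{(\lambda)}\|\mathsf P_2):\lambda\in[0,1],\ D(\mathsf P^{(\lambda)}\|\mathsf P_1)\ge\gamma\}$. - $\mathcal B(\gamma)=\{(E_1,E_2):E_1\le E_1(\gamma),\ E_2\le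 E_2(\gamma)\}$. - $\mathcal R_\gamma$ is the $\gamma$-almost-fixed-length region: $(E_1,E_2)\in\mathcal R_\gamma$ if for every $\delta>0$ there exist $l\in\mathbb Z^+$, $C>0$, $n_0$, and for every $n\ge n_0$ a test $(\tau_n,d_n)$ ($\tau_n$ a stopping time for the natural filtration of $X_1,X_2,\dots$, $d_n\in\{1,2\}$ a function of $X_1,\dots,X_{\tau_n}$) with $\tau_n\le Cn^l$, $\mathsf P_i(\tau_n>n)\le e^{-\gamma n}$ ($i=1,2$), $\mathsf P_1(d_n=2)\le e^{-(E_1-\delta)n}$ and $\mathsf P_2(d_n=1)\le e^{-(E_2-\delta)n}$. Two-phase test: for $n,k\in\mathbb Z^+$ and reals $\beta_1\le\alpha_1$ and $\alpha$, let $S_n=\frac1n\sum_{j=1}^n\log\frac{\mathsf P_1(X_j)}{\mathsf P_2(X_j)}$ and $T_n=\frac1{kn}\sum_{j=n+1}^{(k+1)n}\log\frac{\mathsf P_1(X_j)}{\mathsf P_2(X_j)}$. - Phase I: if $S_n\ge\alpha_1$, set $\tau=n$ and $d=1$; otherwise, if $S_n\le\beta_1$, set $\tau=n$ and $d=2$; otherwise set $\tau=(k+1)n$. - Phase II (when $\tau=(k+1)n$): $d=1$ if $T_n\ge\alpha$ and $d=2$ if $T_n<\alpha$. *)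

(* Defs.v *)
From Stdlib Require Import Reals Lra List.
Import ListNotations.
Open Scope R_scope.

(* The finite alphabet X is {0, ..., m-1} (m : nat); a pmf on X is a function
   P : nat -> R whose values outside {0..m-1} are irrelevant. *)

Definition sumX (m : nat) (f : nat -> R) : R :=
  fold_right Rplus 0 (map f (seq 0 m)).

Definition is_pmf_full (m : nat) (P : nat -> R) : Prop :=
  (forall x, (x < m)%nat -> 0 < P x) /\ sumX m P = 1.

Definition KL (m : nat) (P Q : nat -> R) : R :=
  sumX m (fun x => P x * ln (P x / Q x)).

Definition tilt (m : nat) (P1 P2 : nat -> R) (l : R) : nat -> R :=
  fun x => Rpower (P1 x) (1 - l) * Rpower (P2 x) l /
           sumX m (fun a => Rpower (P1 a) (1 - l) * Rpower (P2 a) l).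

Definition R_FD (m : nat) (P1 P2 : nat -> R) (E1 E2 : R) : Prop :=
  exists l, 0 <= l <= 1 /\
    E1 <= KL m (tilt m P1 P2 l) P1 /\ E2 <= KL m (tilt m P1 P2 l) P2.

Definition is_max (S : R -> Prop) (v : R) : Prop :=
  S v /\ forall w, S w -> w <= v.

(* E_1(gamma) is the max of this set, E_2(gamma) the max of the next one *)
Definition E1set (m : nat) (P1 P2 : nat -> R) (g : R) : R -> Prop :=
  fun v => exists l, 0 <= l <= 1 /\ KL m (tilt m P1 P2 l) P2 >= g /\
                     v = KL m (tilt m P1 P2 l) P1.
Definition E2set (m : nat) (P1 P2 : nat -> R) (g : R) : R -> Prop :=
  fun v => exists l, 0 <= l <= 1 /\ KL m (tilt m P1 P2 l) P1 >= g /\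
                     v = KL m (tilt m P1 P2 l) P2.

Definition B_region (m : nat) (P1 P2 : nat -> R) (g E1 E2 : R) : Prop :=
  exists e1 e2, is_max (E1set m P1 P2 g) e1 /\ is_max (E2set m P1 P2 g) e2 /\
    E1 <= e1 /\ E2 <= e2.

(* all words of length N over {0..m-1}; a word [x1; ...; xN] lists X_1..X_N *)
Fixpoint words (m N : nat) : list (list nat) :=
  match N with
  | O => [nil]
  | S N' => concat (map (fun a => map (cons a) (words m N')) (seq 0 m))
  end.

Definition prodP (P : nat -> R) (w : list nat) : R :=
  fold_right Rmult 1 (map P w).

Definition prob (m : nat) (P : nat -> R) (N : nat) (E : list nat -> bool) : R :=
  fold_right Rplus 0
    (map (fun w => if E w then prodP P w else 0) (words m N)).

Definition llr (P1 P2 : nat -> R) (x : nat) : R := ln (P1 x / P2 x).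

Definition sumL (f : nat -> R) (w : list nat) : R :=
  fold_right Rplus 0 (map f w).

Definition S_stat (P1 P2 : nat -> R) (n : nat) (w : list nat) : R :=
  sumL (llr P1 P2) (firstn n w) / INR n.

Definition T_stat (P1 P2 : nat -> R) (n k : nat) (w : list nat) : R :=
  sumL (llr P1 P2) (skipn n (firstn ((k + 1) * n) w)) / (INR k * INR n).

(* the two-phase test: returns (tau, d) as a function of X_1..X_{(k+1)n} *)
Definition two_phase (P1 P2 : nat -> R) (n k : nat) (alpha1 beta1 alpha : R)
  (w : list nat) : nat * nat :=
  let s := S_stat P1 P2 n w in
  if Rle_dec alpha1 s then (n, 1%nat)
  else if Rle_dec s beta1 then (n, 2%nat)
  else ((k + 1) * n, if Rle_dec alpha (T_stat P1 P2 n k w) then 1%nat else 2%nat)%nat.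

(* Main.v *)
Require Import Defs.
From Stdlib Require Import Reals List Lra Lia.
Import ListNotations.
Open Scope R_scope.

(* Chernoff bounds with exponential tilting.  Under P1 (resp. P2) the exponential
   moment of -l (resp. 1 - l) times the log-likelihood ratio is Z(l), the normalizer of
   the tilted law P^(l); thresholding the normalized LLR at its mean A(l) under P^(l)
   therefore gives the exponent D(P^(l)||P1) for the event S_n <= A(l) under P1 and
   D(P^(l)||P2) for S_n >= A(l) under P2.  A point of R_FD, or of B(gamma) whose two
   optimal tilts have crossing means, is achieved by a single threshold (then tau = n).
   Otherwise take beta1 = A(l1) <= alpha1 = A(l2) from the maximizers defining
   E1(gamma), E2(gamma), and alpha = A(l0) from (E1, E2) = gamma + k (a, b): continuing
   costs exponent at least gamma, and a phase-II error needs both a continuation and a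
   wrong phase-II decision, with exponent gamma + k D(P^(l0)||Pi).  The factor 2 of
   the union bound is absorbed by delta. *)

Definition lsum {A : Type} (f : A -> R) (l : list A) : R := fold_right Rplus 0 (map f l).

Lemma lsum_app {A : Type} (f : A -> R) (l1 l2 : list A) :
  lsum f (l1 ++ l2) = lsum f l1 + lsum f l2.
Proof. induction l1 as [|a l1 IH]; unfold lsum in *; simpl; [lra|]. rewrite IH; lra. Qed.

Lemma lsum_concat {A : Type} (f : A -> R) (L : list (list A)) :
  lsum f (concat L) = lsum (lsum f) L.
Proof. induction L as [|l L IH]; [reflexivity|]. simpl. rewrite lsum_app, IH. reflexivity. Qed.

Lemma lsum_ext_in {A : Type} (f g : A -> R) (l : list A) :
  (forall x, In x l -> f x = g x) -> lsum f l = lsum g l.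
Proof. intros H. unfold lsum. f_equal. apply map_ext_in. exact H. Qed.

Lemma lsum_le {A : Type} (f g : A -> R) (l : list A) :
  (forall x, In x l -> f x <= g x) -> lsum f l <= lsum g l.
Proof.
  induction l as [|a l IH]; unfold lsum in *; simpl; intros H; [lra|].
  assert (f a <= g a) by auto.
  assert (fold_right Rplus 0 (map f l) <= fold_right Rplus 0 (map g l)) by auto.
  lra.
Qed.

Lemma lsum_plus {A : Type} (f g : A -> R) (l : list A) :
  lsum (fun x => f x + g x) l = lsum f l + lsum g l.
Proof. induction l as [|a l IH]; unfold lsum in *; simpl; [lra|]. rewrite IH; lra. Qed.

Lemma lsum_scal {A : Type} (c : R) (f : A -> R) (l : list A) :
  lsum (fun x => c * f x) l = c * lsum f l.
Proof. induction l as [|a l IH]; unfold lsum in *; simpl; [lra|]. rewrite IH; lra. Qed.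

Lemma lsum_pos {A : Type} (f : A -> R) (l : list A) :
  l <> [] -> (forall x, In x l -> 0 < f x) -> 0 < lsum f l.
Proof.
  induction l as [|a [|b l] IH]; intros Hl H; unfold lsum in *; simpl in *.
  - contradiction.
  - rewrite Rplus_0_r. auto.
  - assert (0 < f a) by auto.
    assert (0 < f b + fold_right Rplus 0 (map f l)) by (apply IH; [discriminate | auto]).
    lra.
Qed.

Lemma sumX_ext (m : nat) (f g : nat -> R) :
  (forall x, (x < m)%nat -> f x = g x) -> sumX m f = sumX m g.
Proof. intros H. apply lsum_ext_in. intros x Hx. apply in_seq in Hx. apply H; lia. Qed.

Lemma sumX_plus (m : nat) (f g : nat -> R) :
  sumX m (fun x => f x + g x) = sumX m f + sumX m g.
Proof. exact (lsum_plus f g (seq 0 m)). Qed.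

Lemma sumX_scal (m : nat) (c : R) (f : nat -> R) :
  sumX m (fun x => c * f x) = c * sumX m f.
Proof. exact (lsum_scal c f (seq 0 m)). Qed.

Lemma sumX_pos (m : nat) (f : nat -> R) :
  (0 < m)%nat -> (forall x, (x < m)%nat -> 0 < f x) -> 0 < sumX m f.
Proof.
  intros Hm H. apply lsum_pos.
  - destruct m; [lia | discriminate].
  - intros x Hx. apply in_seq in Hx. apply H; lia.
Qed.

Lemma prodP_app (P : nat -> R) (u v : list nat) :
  prodP P (u ++ v) = prodP P u * prodP P v.
Proof. induction u as [|a u IH]; unfold prodP in *; simpl; [ring|]. rewrite IH; ring. Qed.

Lemma prodP_nonneg (m : nat) (P : nat -> R) (w : list nat) :
  (forall x, (x < m)%nat -> 0 < P x) -> Forall (fun x => (x < m)%nat) w -> 0 <= prodP P w.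
Proof.
  intros HP H. induction H; unfold prodP in *; simpl; [lra|].
  apply Rmult_le_pos; [left; auto | auto].
Qed.

Lemma words_spec (m N : nat) (w : list nat) :
  In w (words m N) -> length w = N /\ Forall (fun x => (x < m)%nat) w.
Proof.
  revert w; induction N as [|N IH]; simpl; intros w H.
  - destruct H as [<- | []]. auto.
  - apply in_concat in H as [l [Hl Hw]].
    apply in_map_iff in Hl as [a [<- Ha]].
    apply in_map_iff in Hw as [u [<- Hu]].
    apply in_seq in Ha. destruct (IH u Hu) as [Hlen Hall].
    simpl. split; [lia | constructor; [lia | exact Hall]].
Qed.

Lemma lsum_words_S (m N : nat) (F : list nat -> R) :
  lsum F (words m (S N)) = sumX m (fun a => lsum (fun w => F (a :: w)) (words m N)).
Proof.
  simpl. rewrite lsum_concat. unfold sumX, lsum at 1 3. rewrite map_map.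
  f_equal. apply map_ext. intro a. unfold lsum. rewrite map_map. reflexivity.
Qed.

Lemma lsum_words_add (m n j : nat) (F : list nat -> R) :
  lsum F (words m (n + j)) =
  lsum (fun u => lsum (fun v => F (u ++ v)) (words m j)) (words m n).
Proof.
  revert F; induction n as [|n IH]; intros F.
  - unfold lsum at 2; simpl. rewrite Rplus_0_r. reflexivity.
  - simpl plus. rewrite !lsum_words_S. apply sumX_ext. intros a _. apply IH.
Qed.

Lemma lsum_words_prodP (m N : nat) (f : nat -> R) :
  lsum (prodP f) (words m N) = sumX m f ^ N.
Proof.
  induction N as [|N IH].
  - unfold lsum, prodP; simpl. ring.
  - rewrite lsum_words_S, <- tech_pow_Rmult, <- IH.
    rewrite (sumX_ext _ _ (fun a => lsum (prodP f) (words m N) * f a)).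
    + rewrite sumX_scal. apply Rmult_comm.
    + intros a _. unfold prodP at 1; simpl. fold (prodP f).
      rewrite Rmult_comm, lsum_scal. reflexivity.
Qed.

Section ExponentialMoments.
Variables (m : nat) (P L : nat -> R).

Definition mgf (c : R) : R := sumX m (fun x => P x * exp (c * L x)).

Lemma prodP_mul_exp (c : R) (u : list nat) :
  prodP P u * exp (c * sumL L u) = prodP (fun x => P x * exp (c * L x)) u.
Proof.
  induction u as [|a u IH]; unfold prodP, sumL, lsum in *; simpl.
  - rewrite Rmult_0_r, exp_0. ring.
  - rewrite <- IH, Rmult_plus_distr_l, exp_plus. ring.
Qed.

Lemma lsum_words_exp (c t : R) (n : nat) :
  lsum (fun u => prodP P u * exp (c * (sumL L u - t))) (words m n) = exp (- c * t) * mgf c ^ n.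
Proof.
  unfold mgf. rewrite <- lsum_words_prodP, <- lsum_scal. apply lsum_ext_in. intros u _.
  rewrite <- prodP_mul_exp, <- Rmult_assoc, (Rmult_comm (exp _)), Rmult_assoc, <- exp_plus.
  f_equal. f_equal. ring.
Qed.

Lemma lsum_words_exp_blocks (c1 t1 c2 t2 : R) (n j : nat) :
  lsum (fun w => prodP P w *
          exp (c1 * (sumL L (firstn n w) - t1) + c2 * (sumL L (skipn n w) - t2)))
       (words m (n + j)) =
  exp (- c1 * t1) * mgf c1 ^ n * (exp (- c2 * t2) * mgf c2 ^ j).
Proof.
  rewrite lsum_words_add, <- !lsum_words_exp, Rmult_comm, <- lsum_scal.
  apply lsum_ext_in. intros u Hu. destruct (words_spec _ _ _ Hu) as [Hlen _].
  rewrite Rmult_comm, <- lsum_scal. apply lsum_ext_in. intros v _.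
  rewrite firstn_app, skipn_app, firstn_all2, skipn_all2 by lia.
  rewrite Hlen, Nat.sub_diag, firstn_0, skipn_0, app_nil_r. simpl.
  rewrite prodP_app, exp_plus. ring.
Qed.

Lemma mgf_0 : sumX m P = 1 -> mgf 0 = 1.
Proof.
  intros HS. rewrite <- HS. apply sumX_ext. intros x _. rewrite Rmult_0_l, exp_0. ring.
Qed.

End ExponentialMoments.

Section Markov.
Variables (m : nat) (P : nat -> R).
Hypothesis P_pos : forall x, (x < m)%nat -> 0 < P x.

Lemma prob_le_expectation (N : nat) (E : list nat -> bool) (G : list nat -> R) :
  (forall w, 0 <= G w) -> (forall w, In w (words m N) -> E w = true -> 1 <= G w) ->
  prob m P N E <= lsum (fun w => prodP P w * G w) (words m N).
Proof.
  intros HG H. apply lsum_le. intros w Hw.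
  pose proof (prodP_nonneg m P w P_pos (proj2 (words_spec _ _ _ Hw))).
  specialize (HG w). specialize (H w Hw). destruct (E w).
  - specialize (H eq_refl). nra.
  - nra.
Qed.

Lemma prob_le_exp (N : nat) (E : list nat -> bool) (a : list nat -> R) :
  (forall w, In w (words m N) -> E w = true -> 0 <= a w) ->
  prob m P N E <= lsum (fun w => prodP P w * exp (a w)) (words m N).
Proof.
  intros H. apply prob_le_expectation.
  - intros w. left. apply exp_pos.
  - intros w Hw HE. pose proof (exp_ineq1_le (a w)). specialize (H w Hw HE). lra.
Qed.

Lemma prob_le_exp_union (N : nat) (E : list nat -> bool) (a b : list nat -> R) :
  (forall w, In w (words m N) -> E w = true -> 0 <= a w \/ 0 <= b w) ->
  prob m P N E <= lsum (fun w => prodP P w * exp (a w)) (words m N)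
                + lsum (fun w => prodP P w * exp (b w)) (words m N).
Proof.
  intros H. rewrite <- lsum_plus.
  rewrite (lsum_ext_in _ (fun w => prodP P w * (exp (a w) + exp (b w)))) by (intros; ring).
  apply prob_le_expectation.
  - intros w. pose proof (exp_pos (a w)). pose proof (exp_pos (b w)). lra.
  - intros w Hw HE. pose proof (exp_ineq1_le (a w)). pose proof (exp_ineq1_le (b w)).
    pose proof (exp_pos (a w)). pose proof (exp_pos (b w)).
    destruct (H w Hw HE); lra.
Qed.

End Markov.

Lemma prob_impossible (m : nat) (P : nat -> R) (N : nat) (E : list nat -> bool) :
  (forall w, In w (words m N) -> E w = false) -> prob m P N E = 0.
Proof.
  intros H. unfold prob. fold (lsum (fun w => if E w then prodP P w else 0) (words m N)).
  rewrite (lsum_ext_in _ (fun w => 0 * 0)) by (intros w Hw; rewrite H by exact Hw; ring).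
  rewrite lsum_scal. ring.
Qed.

Section TwoPhaseTest.
Variables (P1 P2 : nat -> R) (n k : nat) (alpha1 beta1 alpha : R).

Local Notation test := (two_phase P1 P2 n k alpha1 beta1 alpha).
Local Notation S w := (S_stat P1 P2 n w).
Local Notation T w := (T_stat P1 P2 n k w).

Lemma two_phase_stop_le (w : list nat) : (fst (test w) <= (k + 1) * n)%nat.
Proof.
  unfold two_phase. cbv zeta.
  destruct (Rle_dec _ _); simpl; [lia|]. destruct (Rle_dec _ _); simpl; lia.
Qed.

Lemma two_phase_continue (w : list nat) :
  (n < fst (test w))%nat -> beta1 < S w < alpha1.
Proof.
  unfold two_phase. cbv zeta.
  destruct (Rle_dec alpha1 (S w)); simpl; [lia|].
  destruct (Rle_dec (S w) beta1); simpl; [lia|]. lra.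
Qed.

Lemma two_phase_decides_2 (w : list nat) :
  snd (test w) = 2%nat -> S w <= beta1 \/ (S w < alpha1 /\ T w < alpha).
Proof.
  unfold two_phase. cbv zeta.
  destruct (Rle_dec alpha1 (S w)); simpl; [discriminate|].
  destruct (Rle_dec (S w) beta1); simpl; [auto|].
  destruct (Rle_dec alpha (T w)); simpl; [discriminate | lra].
Qed.

Lemma two_phase_decides_1 (w : list nat) :
  snd (test w) = 1%nat -> alpha1 <= S w \/ (beta1 < S w /\ alpha <= T w).
Proof.
  unfold two_phase. cbv zeta.
  destruct (Rle_dec alpha1 (S w)); simpl; [auto|].
  destruct (Rle_dec (S w) beta1); simpl; [discriminate|].
  destruct (Rle_dec alpha (T w)); simpl; [lra | discriminate].
Qed.

End TwoPhaseTest.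

Lemma T_stat_words (P1 P2 : nat -> R) (n k : nat) (w : list nat) :
  length w = ((k + 1) * n)%nat ->
  T_stat P1 P2 n k w = sumL (llr P1 P2) (skipn n w) / INR (k * n).
Proof.
  intros H. unfold T_stat. rewrite firstn_all2 by lia. rewrite mult_INR. reflexivity.
Qed.

Lemma div_le_mul (x d b : R) : 0 < d -> x / d <= b -> x <= d * b.
Proof. intros Hd H. replace x with (d * (x / d)) by (field; lra). nra. Qed.

Lemma le_div_mul (x d b : R) : 0 < d -> b <= x / d -> d * b <= x.
Proof. intros Hd H. replace x with (d * (x / d)) by (field; lra). nra. Qed.

Definition two_phase_guarantee (m : nat) (P1 P2 : nat -> R) (n k : nat)
  (alpha1 beta1 alpha gamma e1 e2 : R) : Prop :=
  let N := ((k + 1) * n)%nat in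
  let test := two_phase P1 P2 n k alpha1 beta1 alpha in
  (forall w, (fst (test w) <= N)%nat) /\
  prob m P1 N (fun w => Nat.ltb n (fst (test w))) <= exp (- gamma * INR n) /\
  prob m P2 N (fun w => Nat.ltb n (fst (test w))) <= exp (- gamma * INR n) /\
  prob m P1 N (fun w => Nat.eqb (snd (test w)) 2) <= exp (- e1 * INR n) /\
  prob m P2 N (fun w => Nat.eqb (snd (test w)) 1) <= exp (- e2 * INR n).

Lemma exp_le (a b : R) : a <= b -> exp a <= exp b.
Proof. intros [H | ->]; [left; apply exp_increasing; exact H | lra]. Qed.

Lemma two_exp_le_exp_slack (n k Ka Kb Kc E g d : R) :
  0 <= n -> 0 <= k -> E <= Ka -> g <= Kb -> E <= g + k * Kc -> 2 <= exp (d * n) ->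
  exp (- n * Ka) + exp (- n * Kb) * exp (- (k * n) * Kc) <= exp (- (E - d) * n).
Proof.
  intros Hn Hk HKa HKb HKc H2.
  assert (h1 : exp (- n * Ka) <= exp (- n * E)) by (apply exp_le; nra).
  assert (h2 : exp (- n * Kb) * exp (- (k * n) * Kc) <= exp (- n * E))
    by (rewrite <- exp_plus; apply exp_le; nra).
  replace (- (E - d) * n) with (d * n + - n * E) by ring.
  rewrite exp_plus. pose proof (exp_pos (- n * E)). nra.
Qed.

Lemma exp_eventually_ge_2 (d : R) : 0 < d ->
  exists n0 : nat, forall n, (n0 <= n)%nat -> 2 <= exp (d * INR n).
Proof.
  intros Hd. destruct (INR_unbounded (/ d)) as [n0 Hn0]. exists n0. intros n Hn.
  apply le_INR in Hn.
  assert (1 <= d * INR n).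
  { replace 1 with (d * / d) by (field; lra). apply Rmult_le_compat_l; lra. }
  pose proof (exp_ineq1_le (d * INR n)). lra.
Qed.

Section TiltedTests.
Variables (m : nat) (P1 P2 : nat -> R).
Hypothesis P1_pos : forall x, (x < m)%nat -> 0 < P1 x.
Hypothesis P2_pos : forall x, (x < m)%nat -> 0 < P2 x.
Hypothesis P1_sum : sumX m P1 = 1.
Hypothesis P2_sum : sumX m P2 = 1.
Hypothesis m_pos : (0 < m)%nat.

Local Notation L := (llr P1 P2).
Local Notation K1 l := (KL m (tilt m P1 P2 l) P1).
Local Notation K2 l := (KL m (tilt m P1 P2 l) P2).

Definition tilt_norm (l : R) : R := sumX m (fun a => Rpower (P1 a) (1 - l) * Rpower (P2 a) l).

Definition tilt_mean (l : R) : R := sumX m (fun x => tilt m P1 P2 l x * L x).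

Local Notation Z := tilt_norm.
Local Notation A := tilt_mean.

Lemma llr_ln (x : nat) : (x < m)%nat -> L x = ln (P1 x) - ln (P2 x).
Proof.
  intros Hx. unfold llr, Rdiv. rewrite ln_mult, ln_Rinv; auto.
  apply Rinv_0_lt_compat; auto.
Qed.

Lemma tilt_weight_P1 (l : R) (x : nat) : (x < m)%nat ->
  Rpower (P1 x) (1 - l) * Rpower (P2 x) l = P1 x * exp (- l * L x).
Proof.
  intros Hx. rewrite llr_ln by exact Hx. unfold Rpower.
  rewrite <- (exp_ln (P1 x)) at 2 by auto. rewrite <- !exp_plus. f_equal. ring.
Qed.

Lemma tilt_weight_P2 (l : R) (x : nat) : (x < m)%nat ->
  Rpower (P1 x) (1 - l) * Rpower (P2 x) l = P2 x * exp ((1 - l) * L x).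
Proof.
  intros Hx. rewrite llr_ln by exact Hx. unfold Rpower.
  rewrite <- (exp_ln (P2 x)) at 2 by auto. rewrite <- !exp_plus. f_equal. ring.
Qed.

Lemma tilt_norm_pos (l : R) : 0 < Z l.
Proof.
  apply sumX_pos; auto. intros. unfold Rpower. apply Rmult_lt_0_compat; apply exp_pos.
Qed.

Lemma mgf_P1_tilt (l : R) : mgf m P1 L (- l) = Z l.
Proof. apply sumX_ext. intros x Hx. rewrite tilt_weight_P1; auto. Qed.

Lemma mgf_P2_tilt (l : R) : mgf m P2 L (1 - l) = Z l.
Proof. apply sumX_ext. intros x Hx. rewrite tilt_weight_P2; auto. Qed.

Lemma sumX_tilt (l : R) : sumX m (tilt m P1 P2 l) = 1.
Proof.
  pose proof (tilt_norm_pos l) as HZ.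
  unfold tilt. fold (Z l).
  rewrite (sumX_ext _ _ (fun x => / Z l * (Rpower (P1 x) (1 - l) * Rpower (P2 x) l)))
    by (intros; unfold Rdiv; ring).
  rewrite sumX_scal. fold (Z l). field. lra.
Qed.

(* ln (tilt x / Q x) = c * L x - ln Z, with c = -l for Q = P1 and c = 1 - l for Q = P2. *)
Lemma KL_tilt_gen (Q : nat -> R) (c l : R) :
  (forall x, (x < m)%nat -> 0 < Q x) ->
  (forall x, (x < m)%nat -> Rpower (P1 x) (1 - l) * Rpower (P2 x) l = Q x * exp (c * L x)) ->
  KL m (tilt m P1 P2 l) Q = c * A l - ln (Z l).
Proof.
  intros HQ Hw. pose proof (tilt_norm_pos l) as HZ.
  unfold KL, A.
  rewrite (sumX_ext _ _ (fun x => c * (tilt m P1 P2 l x * L x) + - ln (Z l) * tilt m P1 P2 l x)).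
  - rewrite sumX_plus, !sumX_scal, sumX_tilt. ring.
  - intros x Hx. unfold tilt. fold (Z l). rewrite Hw by exact Hx.
    replace (Q x * exp (c * L x) / Z l / Q x) with (exp (c * L x + - ln (Z l))).
    + rewrite ln_exp. ring.
    + rewrite exp_plus, exp_Ropp, exp_ln by exact HZ. field.
      specialize (HQ x Hx). lra.
Qed.

Lemma KL_tilt_P1 (l : R) : K1 l = - l * A l - ln (Z l).
Proof. apply KL_tilt_gen; [exact P1_pos | intros; apply tilt_weight_P1; auto]. Qed.

Lemma KL_tilt_P2 (l : R) : K2 l = (1 - l) * A l - ln (Z l).
Proof. apply KL_tilt_gen; [exact P2_pos | intros; apply tilt_weight_P2; auto]. Qed.

Lemma KL_tilt_0_P1 : K1 0 = 0.
Proof.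
  rewrite KL_tilt_P1, <- mgf_P1_tilt, Ropp_0, mgf_0 by exact P1_sum. rewrite ln_1. ring.
Qed.

Lemma KL_tilt_1_P2 : K2 1 = 0.
Proof.
  rewrite KL_tilt_P2, <- mgf_P2_tilt, Rminus_diag, mgf_0 by exact P2_sum. rewrite ln_1. ring.
Qed.

Lemma tilt_block (c l : R) (n : nat) :
  exp (- c * (INR n * A l)) * Z l ^ n = exp (- INR n * (c * A l - ln (Z l))).
Proof.
  rewrite <- Rpower_pow by apply tilt_norm_pos. unfold Rpower. rewrite <- exp_plus.
  f_equal. ring.
Qed.

Lemma lsum_words_tilt_P1 (la lb : R) (n j : nat) :
  lsum (fun w => prodP P1 w *
          exp (- la * (sumL L (firstn n w) - INR n * A la)
               + - lb * (sumL L (skipn n w) - INR j * A lb)))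
       (words m (n + j)) = exp (- INR n * K1 la) * exp (- INR j * K1 lb).
Proof.
  rewrite lsum_words_exp_blocks, !mgf_P1_tilt, !tilt_block, !KL_tilt_P1. reflexivity.
Qed.

Lemma lsum_words_tilt_P2 (la lb : R) (n j : nat) :
  lsum (fun w => prodP P2 w *
          exp ((1 - la) * (sumL L (firstn n w) - INR n * A la)
               + (1 - lb) * (sumL L (skipn n w) - INR j * A lb)))
       (words m (n + j)) = exp (- INR n * K2 la) * exp (- INR j * K2 lb).
Proof.
  rewrite lsum_words_exp_blocks, !mgf_P2_tilt, !tilt_block, !KL_tilt_P2. reflexivity.
Qed.

Lemma prob_P1_first_block_le (l : R) (n j : nat) (E : list nat -> bool) : 0 <= l ->
  (forall w, In w (words m (n + j)) -> E w = true -> sumL L (firstn n w) <= INR n * A l) ->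
  prob m P1 (n + j) E <= exp (- INR n * K1 l).
Proof.
  intros Hl H. eapply Rle_trans.
  - apply (prob_le_exp m P1 P1_pos _ _ (fun w => - l * (sumL L (firstn n w) - INR n * A l)
             + - 0 * (sumL L (skipn n w) - INR j * A 0))).
    intros w Hw HE. specialize (H w Hw HE). nra.
  - rewrite lsum_words_tilt_P1, KL_tilt_0_P1, Rmult_0_r, exp_0. lra.
Qed.

Lemma prob_P2_first_block_le (l : R) (n j : nat) (E : list nat -> bool) : l <= 1 ->
  (forall w, In w (words m (n + j)) -> E w = true -> INR n * A l <= sumL L (firstn n w)) ->
  prob m P2 (n + j) E <= exp (- INR n * K2 l).
Proof.
  intros Hl H. eapply Rle_trans.
  - apply (prob_le_exp m P2 P2_pos _ _ (fun w => (1 - l) * (sumL L (firstn n w) - INR n * A l)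
             + (1 - 1) * (sumL L (skipn n w) - INR j * A 1))).
    intros w Hw HE. specialize (H w Hw HE). nra.
  - rewrite lsum_words_tilt_P2, KL_tilt_1_P2, Rmult_0_r, exp_0. lra.
Qed.

Lemma prob_P1_two_phase_le (la lb lc : R) (n j : nat) (E : list nat -> bool) :
  0 <= la -> 0 <= lb -> 0 <= lc ->
  (forall w, In w (words m (n + j)) -> E w = true ->
     sumL L (firstn n w) <= INR n * A la \/
     (sumL L (firstn n w) <= INR n * A lb /\ sumL L (skipn n w) <= INR j * A lc)) ->
  prob m P1 (n + j) E <= exp (- INR n * K1 la) + exp (- INR n * K1 lb) * exp (- INR j * K1 lc).
Proof.
  intros Ha Hb Hc H. eapply Rle_trans.
  - apply (prob_le_exp_union m P1 P1_pos _ _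
             (fun w => - la * (sumL L (firstn n w) - INR n * A la)
                       + - 0 * (sumL L (skipn n w) - INR j * A 0))
             (fun w => - lb * (sumL L (firstn n w) - INR n * A lb)
                       + - lc * (sumL L (skipn n w) - INR j * A lc))).
    intros w Hw HE. destruct (H w Hw HE) as [H1 | [H1 H2]]; [left | right]; nra.
  - rewrite !lsum_words_tilt_P1, KL_tilt_0_P1, Rmult_0_r, exp_0. lra.
Qed.

Lemma prob_P2_two_phase_le (la lb lc : R) (n j : nat) (E : list nat -> bool) :
  la <= 1 -> lb <= 1 -> lc <= 1 ->
  (forall w, In w (words m (n + j)) -> E w = true ->
     INR n * A la <= sumL L (firstn n w) \/
     (INR n * A lb <= sumL L (firstn n w) /\ INR j * A lc <= sumL L (skipn n w))) ->
  prob m P2 (n + j) E <= exp (- INR n * K2 la) + exp (- INR n * K2 lb) * exp (- INR j * K2 lc).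
Proof.
  intros Ha Hb Hc H. eapply Rle_trans.
  - apply (prob_le_exp_union m P2 P2_pos _ _
             (fun w => (1 - la) * (sumL L (firstn n w) - INR n * A la)
                       + (1 - 1) * (sumL L (skipn n w) - INR j * A 1))
             (fun w => (1 - lb) * (sumL L (firstn n w) - INR n * A lb)
                       + (1 - lc) * (sumL L (skipn n w) - INR j * A lc))).
    intros w Hw HE. destruct (H w Hw HE) as [H1 | [H1 H2]]; [left | right]; nra.
  - rewrite !lsum_words_tilt_P2, KL_tilt_1_P2, Rmult_0_r, exp_0. lra.
Qed.


Lemma fixed_threshold_errors (l1 l2 c a : R) (n k : nat) :
  0 <= l1 -> l2 <= 1 -> A l2 <= c <= A l1 -> (1 <= n)%nat ->
  let test := two_phase P1 P2 n k c c a in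
  prob m P1 ((k + 1) * n) (fun w => Nat.eqb (snd (test w)) 2) <= exp (- INR n * K1 l1) /\
  prob m P2 ((k + 1) * n) (fun w => Nat.eqb (snd (test w)) 1) <= exp (- INR n * K2 l2).
Proof.
  intros Hl1 Hl2 Hc Hn test.
  assert (Hnpos : 0 < INR n) by (apply lt_0_INR; lia).
  replace ((k + 1) * n)%nat with (n + k * n)%nat by lia.
  split.
  - apply prob_P1_first_block_le; [exact Hl1|]. intros w _ HE.
    apply Nat.eqb_eq, two_phase_decides_2 in HE.
    apply div_le_mul; [exact Hnpos|]. unfold S_stat in HE. lra.
  - apply prob_P2_first_block_le; [exact Hl2|]. intros w _ HE.
    apply Nat.eqb_eq, two_phase_decides_1 in HE.
    apply le_div_mul; [exact Hnpos|]. unfold S_stat in HE. lra.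
Qed.

Lemma two_phase_continue_probs (la lb l0 : R) (n k : nat) :
  0 <= la -> lb <= 1 -> (1 <= n)%nat ->
  let test := two_phase P1 P2 n k (A la) (A lb) (A l0) in
  prob m P1 ((k + 1) * n) (fun w => Nat.ltb n (fst (test w))) <= exp (- INR n * K1 la) /\
  prob m P2 ((k + 1) * n) (fun w => Nat.ltb n (fst (test w))) <= exp (- INR n * K2 lb).
Proof.
  intros Hla Hlb Hn test.
  assert (Hnpos : 0 < INR n) by (apply lt_0_INR; lia).
  replace ((k + 1) * n)%nat with (n + k * n)%nat by lia.
  split.
  - apply prob_P1_first_block_le; [exact Hla|]. intros w _ HE.
    apply Nat.ltb_lt, two_phase_continue in HE.
    apply div_le_mul; [exact Hnpos|]. unfold S_stat in HE. lra.
  - apply prob_P2_first_block_le; [exact Hlb|]. intros w _ HE.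
    apply Nat.ltb_lt, two_phase_continue in HE.
    apply le_div_mul; [exact Hnpos|]. unfold S_stat in HE. lra.
Qed.

Lemma two_phase_error_probs (la lb l0 : R) (n k : nat) :
  0 <= la <= 1 -> 0 <= lb <= 1 -> 0 <= l0 <= 1 -> (1 <= n)%nat -> (1 <= k)%nat ->
  let test := two_phase P1 P2 n k (A la) (A lb) (A l0) in
  prob m P1 ((k + 1) * n) (fun w => Nat.eqb (snd (test w)) 2)
    <= exp (- INR n * K1 lb) + exp (- INR n * K1 la) * exp (- INR (k * n) * K1 l0) /\
  prob m P2 ((k + 1) * n) (fun w => Nat.eqb (snd (test w)) 1)
    <= exp (- INR n * K2 la) + exp (- INR n * K2 lb) * exp (- INR (k * n) * K2 l0).
Proof.
  intros Hla Hlb Hl0 Hn Hk test.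
  assert (Hnpos : 0 < INR n) by (apply lt_0_INR; lia).
  assert (Hknpos : 0 < INR (k * n)) by (apply lt_0_INR; lia).
  assert (Hlen : forall w, In w (words m (n + k * n)) -> length w = ((k + 1) * n)%nat)
    by (intros w Hw; rewrite (proj1 (words_spec _ _ _ Hw)); lia).
  replace ((k + 1) * n)%nat with (n + k * n)%nat by lia.
  split.
  - apply prob_P1_two_phase_le; try lra. intros w Hw HE.
    apply Nat.eqb_eq, two_phase_decides_2 in HE.
    unfold S_stat in HE. rewrite T_stat_words in HE by auto.
    destruct HE as [HS | [HS HT]]; [left | right; split];
      apply div_le_mul; auto; lra.
  - apply prob_P2_two_phase_le; try lra. intros w Hw HE.
    apply Nat.eqb_eq, two_phase_decides_1 in HE.
    unfold S_stat in HE. rewrite T_stat_words in HE by auto.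
    destruct HE as [HS | [HS HT]]; [left | right; split];
      apply le_div_mul; auto; lra.
Qed.


Lemma fixed_threshold_guarantee (l1 l2 c g E1 E2 d : R) (n k : nat) :
  0 <= l1 -> l2 <= 1 -> A l2 <= c <= A l1 ->
  E1 <= K1 l1 -> E2 <= K2 l2 -> 0 < d -> (1 <= n)%nat ->
  two_phase_guarantee m P1 P2 n k c c 0 g (E1 - d) (E2 - d).
Proof.
  intros Hl1 Hl2 Hc HE1 HE2 Hd Hn.
  assert (Hnpos : 0 < INR n) by (apply lt_0_INR; lia).
  assert (Hstop : forall P, prob m P ((k + 1) * n)
            (fun w => Nat.ltb n (fst (two_phase P1 P2 n k c c 0 w))) <= exp (- g * INR n)).
  { intros P. rewrite prob_impossible; [left; apply exp_pos|]. intros w _.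
    apply Nat.ltb_ge, Nat.nlt_ge. intros Hlt. apply two_phase_continue in Hlt. lra. }
  destruct (fixed_threshold_errors l1 l2 c 0 n k Hl1 Hl2 Hc Hn) as [Herr1 Herr2].
  repeat split.
  - apply two_phase_stop_le.
  - apply Hstop.
  - apply Hstop.
  - eapply Rle_trans; [exact Herr1 | apply exp_le; nra].
  - eapply Rle_trans; [exact Herr2 | apply exp_le; nra].
Qed.

Lemma tilted_thresholds_guarantee (la lb l0 g E1 E2 d : R) (n k : nat) :
  0 <= la <= 1 -> 0 <= lb <= 1 -> 0 <= l0 <= 1 ->
  g <= K1 la -> g <= K2 lb -> E1 <= K1 lb -> E2 <= K2 la ->
  E1 <= g + INR k * K1 l0 -> E2 <= g + INR k * K2 l0 ->
  2 <= exp (d * INR n) -> (1 <= n)%nat -> (1 <= k)%nat ->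
  two_phase_guarantee m P1 P2 n k (A la) (A lb) (A l0) g (E1 - d) (E2 - d).
Proof.
  intros Hla Hlb Hl0 Hg1 Hg2 HE1 HE2 HF1 HF2 Hd Hn Hk.
  pose proof (pos_INR n) as Hn0. pose proof (pos_INR k) as Hk0.
  destruct (two_phase_continue_probs la lb l0 n k (proj1 Hla) (proj2 Hlb) Hn) as [Hc1 Hc2].
  destruct (two_phase_error_probs la lb l0 n k Hla Hlb Hl0 Hn Hk) as [Herr1 Herr2].
  rewrite mult_INR in Herr1, Herr2.
  repeat split.
  - apply two_phase_stop_le.
  - eapply Rle_trans; [exact Hc1 | apply exp_le; nra].
  - eapply Rle_trans; [exact Hc2 | apply exp_le; nra].
  - eapply Rle_trans; [exact Herr1 | apply two_exp_le_exp_slack with g; auto].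
  - eapply Rle_trans; [exact Herr2 | apply two_exp_le_exp_slack with g; auto].
Qed.

End TiltedTests.

Theorem proposition1
  (m : nat) (P1 P2 : nat -> R)
  (HP1 : is_pmf_full m P1) (HP2 : is_pmf_full m P2)
  (Hdist : exists x, (x < m)%nat /\ P1 x <> P2 x)
  (lstar Dstar : R)
  (Hlstar : 0 <= lstar <= 1)
  (Hchern : KL m (tilt m P1 P2 lstar) P1 = KL m (tilt m P1 P2 lstar) P2)
  (HDstar : Dstar = KL m (tilt m P1 P2 lstar) P1)
  (gamma : R) (Hg : 0 <= gamma <= Dstar)
  (k : nat) (Hk : (1 <= k)%nat)
  (E1 E2 : R)
  (HE : R_FD m P1 P2 E1 E2 \/ B_region m P1 P2 gamma E1 E2)
  (HEk : exists a b, R_FD m P1 P2 a b /\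
           E1 = gamma + INR k * a /\ E2 = gamma + INR k * b) :
  forall delta, delta > 0 ->
  exists alpha1 beta1 alpha : R, beta1 <= alpha1 /\
  exists n0 : nat, forall n : nat, (n0 <= n)%nat ->
    let N := ((k + 1) * n)%nat in
    let test := two_phase P1 P2 n k alpha1 beta1 alpha in
    (forall w, (fst (test w) <= N)%nat) /\
    prob m P1 N (fun w => Nat.ltb n (fst (test w))) <= exp (- gamma * INR n) /\
    prob m P2 N (fun w => Nat.ltb n (fst (test w))) <= exp (- gamma * INR n) /\
    prob m P1 N (fun w => Nat.eqb (snd (test w)) 2) <= exp (- (E1 - delta) * INR n) /\
    prob m P2 N (fun w => Nat.eqb (snd (test w)) 1) <= exp (- (E2 - delta) * INR n).
Proof.
  intros delta Hd.
  destruct HP1 as [P1_pos P1_sum], HP2 as [P2_pos P2_sum].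
  assert (m_pos : (0 < m)%nat) by (destruct Hdist as [x [Hx _]]; lia).
  pose (A := tilt_mean m P1 P2).
  destruct HEk as [a [b [[l0 [Hl0 [Ha Hb]]] [HE1 HE2]]]].
  destruct HE as [[l [Hl [H1 H2]]] | [e1 [e2 [[[l1 [Hl1 [Hg1 He1]]] _]
                                              [[[l2 [Hl2 [Hg2 He2]]] _] [H1 H2]]]]]].
  - exists (A l), (A l), 0. split; [lra|]. exists 1%nat. intros n Hn.
    apply (fixed_threshold_guarantee m P1 P2 P1_pos P2_pos P1_sum P2_sum m_pos l l);
      unfold A; auto; try lra; lia.
  - destruct (Rle_lt_dec (A l1) (A l2)) as [Hord | Hcross].
    + assert (HF1 : E1 <= gamma + INR k * KL m (tilt m P1 P2 l0) P1)
        by (pose proof (pos_INR k); nra).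
      assert (HF2 : E2 <= gamma + INR k * KL m (tilt m P1 P2 l0) P2)
        by (pose proof (pos_INR k); nra).
      destruct (exp_eventually_ge_2 delta Hd) as [n0 Hn0].
      exists (A l2), (A l1), (A l0). split; [exact Hord|]. exists (Nat.max 1 n0).
      intros n Hn.
      apply (tilted_thresholds_guarantee m P1 P2 P1_pos P2_pos P1_sum P2_sum m_pos l2 l1 l0);
        auto; try lra; [apply Hn0 | ..]; lia.
    + (* With crossing means the single threshold A l1 controls both errors. *)
      exists (A l1), (A l1), 0. split; [lra|]. exists 1%nat. intros n Hn.
      apply (fixed_threshold_guarantee m P1 P2 P1_pos P2_pos P1_sum P2_sum m_pos l1 l2);
        unfold A in *; auto; try lra; lia.
Qed.
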